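(* Let $n\ge3$ and $k>1$, and let $\zeta:M_kWB_n\to\mathrm{GL}_n(\mathbb{C})$ be a complex homogeneous $2$-local representation of $M_kWB_n$. Then $\zeta$ is equivalent to one of the following $3\cdot2^{k-1}+1$ (types of) representations. One is the trivial representation, sending each generator to the identity matrix. The remaining $3\cdot2^{k-1}$ are of the form $$\zeta(\sigma_i)=E_i(A),\qquad \zeta(\rho_i^\alpha)=E_i(Y_\alpha)\qquad(1\le i\le n-1,\ 0\le\alpha\le k-1),$$ where $A$ and the $Y_\alpha$ satisfy one of the following: (i) $A=\begin{pmatrix}1-bc&b\\c&0\end{pmatrix}$ with $b,c\in\mathbb{C}$, $bc\ne0$, or $A=\begin{pmatrix}0&b\\ \frac{1-d}{b}&d\end{pmatrix}$ with $b,d\in\mathbb{C}$, $b\neq0$, $d\ne1$; and, with the same $b$, $Y_0=\begin{pmatrix}0&b\\ \frac1b&0\end{pmatrix}$ and, for each $1\le\alpha\le k-1$, $Y_\alpha=\begin{pmatrix}0&b\\ \frac1b&0\end{pmatrix}$ or $Y_\alpha=\begin{pmatrix}1&0\\0&1\end{pmatrix}$; (ii) $A=\begin{pmatrix}0&b\\c&0\end{pmatrix}$ with $b,c\in\mathbb{C}$, $bc\neq0$; and $Y_0=\begin{pmatrix}0&x_0\\ \frac1{x_0}&0\end{pmatrix}$ with $x_0\in\mathbb{C}\setminus\{0\}$ and, for each $1\le\alpha\le k-1$, $Y_\alpha=\begin{pmatrix}0&x_\alpha\\ \frac1{x_\alpha}&0\end{pmatrix}$ with $x_\alpha\in\mathbb{C}\setminus\{0\}$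 or $Y_\alpha=\begin{pmatrix}1&0\\0&1\end{pmatrix}$. (Each choice of one of the three forms for $A$ and, for each $1\le\alpha\le k-1$, one of the two allowed forms for $Y_\alpha$, gives one type.)
   Context: For $n\ge2$, $k>1$, the multi-welded braid group $M_kWB_n$ is the group generated by $\sigma_1,\dots,\sigma_{n-1}$ and $\rho_1^{\alpha},\dots,\rho_{n-1}^{\alpha}$ for $\alpha=0,1,\dots,k-1$ (here $\alpha$ is a superscript index, not a power), subject to the relations: - $\sigma_i\sigma_{i+1}\sigma_i=\sigma_{i+1}\sigma_i\sigma_{i+1}$ for $1\le i\le n-2$; - $\sigma_i\sigma_j=\sigma_j\sigma_i$ for $|i-j|\ge2$; - $(\rho_i^\alpha)^2=e$ for $1\le i\le n-1$ and all $\alpha$; - $\rho_i^\alpha\rho_j^\alpha=\rho_j^\alpha\rho_i^\alpha$ for $|i-j|\ge2$ and all $\alpha$; - $\rho_i^\alpha\rho_{i+1}^\alpha\rho_i^\alpha=\rho_{i+1}^\alpha\rho_i^\alpha\rho_{i+1}^\alpha$ for $1\le i\le n-2$ and all $\alpha$; - $\sigma_i\rho_j^\alpha=\rho_j^\alpha\sigma_i$ for $|i-j|\ge2$ and all $\alpha$; - $\rho_i^\alpha\rho_j^\beta=\rho_j^\beta\rho_i^\alpha$ for $|i-j|\ge2$ and $\alpha\ne\beta$; - $\sigma_i\rho_{i+1}^0\rho_i^0=\rho_{i+1}^0\rho_i^0\sigma_{i+1}$ for $1\le i\le n-2$; - $\rho_i^0\rho_{i+1}^0\rho_i^\beta=\rho_{i+1}^\beta\rho_i^0\rho_{i+1}^0$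 for $1\le i\le n-2$ and $1\le\beta\le k-1$; - (F1) $\sigma_i\sigma_{i+1}\rho_i^\alpha=\rho_{i+1}^\alpha\sigma_i\sigma_{i+1}$ for $1\le i\le n-2$ and $0\le\alpha\le k-1$. For a $2\times2$ matrix $M$ and $1\le i\le n-1$, $E_i(M)$ denotes the $n\times n$ block diagonal matrix $\mathrm{diag}(I_{i-1},M,I_{n-i-1})$, where $I_r$ is the $r\times r$ identity matrix. A complex homogeneous $2$-local representation of $M_kWB_n$ is a group homomorphism $\zeta:M_kWB_n\to\mathrm{GL}_n(\mathbb{C})$ for which there are matrices $A,Y_0,\dots,Y_{k-1}\in\mathrm{GL}_2(\mathbb{C})$ with $\zeta(\sigma_i)=E_i(A)$ and $\zeta(\rho_i^\alpha)=E_i(Y_\alpha)$ for all $1\le i\le n-1$ and $0\le\alpha\le k-1$. Two representations are equivalent if they are conjugate by a fixed invertible matrix. *)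

(* Defs.v *)
From HB Require Import structures.
From mathcomp Require Import all_boot all_order all_algebra.
From mathcomp Require Import boolp reals complex.

Set Implicit Arguments.
Unset Strict Implicit.
Unset Printing Implicit Defensive.

Import GRing.Theory.

(* A word over X is a sequence of letters (x, e), where (x, false) stands for
   x and (x, true) for its formal inverse. *)
Definition word (X : choiceType) : choiceType := seq (X * bool).

Inductive word_eq (X : choiceType) (rel : word X -> word X -> Prop) :
    word X -> word X -> Prop :=
| WordRefl u : word_eq rel u u
| WordSym u v : word_eq rel u v -> word_eq rel v u
| WordTrans u v w : word_eq rel u v -> word_eq rel v w -> word_eq rel u w
| WordCat u u' v v' :
    word_eq rel u u' -> word_eq rel v v' -> word_eq rel (u ++ v) (u' ++ v')
| WordCancel x e : word_eq rel [:: (x, e); (x, ~~ e)] [::]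
| WordRel u v : rel u v -> word_eq rel u v.

Section PresentedGroup.
Variables (X : choiceType) (rel : word X -> word X -> Prop).

Definition word_eqb (u v : word X) : bool := `[< word_eq rel u v >].

Lemma word_eqb_refl : reflexive word_eqb.
Proof. by move=> u; apply/asboolP; apply: WordRefl. Qed.

Lemma word_eqb_sym : symmetric word_eqb.
Proof. by move=> u v; apply/asboolP/asboolP; apply: WordSym. Qed.

Lemma word_eqb_trans : transitive word_eqb.
Proof.
move=> v u w /asboolP uv /asboolP vw; apply/asboolP; exact: WordTrans uv vw.
Qed.

Canonical word_equiv :=
  EquivRel word_eqb word_eqb_refl word_eqb_sym word_eqb_trans.

(* The group < X | u = v for all u, v such that rel u v >. *)
Definition presented : Type := {eq_quot word_equiv}%qT.
HB.instance Definition _ := Choice.on presented.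
HB.instance Definition _ := Quotient.on presented.

Definition class_of (u : word X) : presented := (\pi_presented u)%qT.

Definition gen (x : X) : presented := class_of [:: (x, false)].

Lemma class_ofP u v : class_of u = class_of v <-> word_eq rel u v.
Proof.
split=> [/eqmodP h|h]; first exact/asboolP.
by apply/eqmodP/asboolP.
Qed.

Lemma class_of_repr (a : presented) : class_of (repr a) = a.
Proof. exact: reprK. Qed.

Definition word_inv (u : word X) : word X := rev [seq (p.1, ~~ p.2) | p <- u].

Lemma word_inv_cat u v : word_inv (u ++ v) = word_inv v ++ word_inv u.
Proof. by rewrite /word_inv map_cat rev_cat. Qed.

Lemma word_invK : involutive word_inv.
Proof.
move=> u; rewrite /word_inv map_rev revK -map_comp -[RHS]map_id.
by apply: eq_map => -[x e] /=; rewrite negbK.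
Qed.

Lemma word_eq_invr u : word_eq rel (u ++ word_inv u) [::].
Proof.
elim: u => [|[x e] u IHu]; first exact: WordRefl.
rewrite -cat1s word_inv_cat -catA (catA u).
apply: WordTrans (WordCancel rel x e).
apply: (WordCat (WordRefl rel [:: (x, e)])).
rewrite -[X in word_eq _ _ X]cat0s.
exact: WordCat IHu (WordRefl _ _).
Qed.

Lemma word_eq_invl u : word_eq rel (word_inv u ++ u) [::].
Proof. by rewrite -[X in _ ++ X]word_invK; exact: word_eq_invr. Qed.

Lemma word_eq_inv u v : word_eq rel u v -> word_eq rel (word_inv u) (word_inv v).
Proof.
move=> uv.
apply: (@WordTrans _ _ _ (word_inv u ++ (v ++ word_inv v))).
  rewrite -[X in word_eq _ X _]cats0.
  by apply: WordCat (WordRefl _ _) _; apply/WordSym/word_eq_invr.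
rewrite catA -[X in word_eq _ _ X]cat0s.
apply: WordCat (WordRefl _ _).
apply: WordTrans (word_eq_invl u).
by apply: WordCat (WordRefl _ _) _; apply: WordSym.
Qed.

Definition presented_one : presented := class_of [::].
Definition presented_mul (a b : presented) : presented :=
  class_of (repr a ++ repr b).
Definition presented_inv (a : presented) : presented :=
  class_of (word_inv (repr a)).

Lemma repr_class_of u : word_eq rel (repr (class_of u)) u.
Proof. by apply/class_ofP; rewrite class_of_repr. Qed.

Lemma presented_mulE u v :
  presented_mul (class_of u) (class_of v) = class_of (u ++ v).
Proof. by apply/class_ofP; apply: WordCat; apply: repr_class_of. Qed.

Lemma presented_invE u : presented_inv (class_of u) = class_of (word_inv u).
Proof. by apply/class_ofP; apply: word_eq_inv; apply: repr_class_of. Qed.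

Lemma presented_mulA : associative presented_mul.
Proof.
move=> a b c.
rewrite -(class_of_repr a) -(class_of_repr b) -(class_of_repr c).
by rewrite !presented_mulE catA.
Qed.

Lemma presented_mul1 : left_id presented_one presented_mul.
Proof. by move=> a; rewrite -(class_of_repr a) presented_mulE. Qed.

Lemma presented_mulr1 : right_id presented_one presented_mul.
Proof. by move=> a; rewrite -(class_of_repr a) presented_mulE cats0. Qed.

Lemma presented_mulV : left_inverse presented_one presented_inv presented_mul.
Proof.
move=> a; rewrite -(class_of_repr a) presented_invE presented_mulE.
exact/class_ofP/word_eq_invl.
Qed.

Lemma presented_mulrV : right_inverse presented_one presented_inv presented_mul.
Proof.
move=> a; rewrite -(class_of_repr a) presented_invE presented_mulE.
exact/class_ofP/word_eq_invr.
Qed.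

HB.instance Definition _ := isGroup.Build presented presented_mulA
  presented_mul1 presented_mulr1 presented_mulV presented_mulrV.

Lemma class_of_cat u v : class_of (u ++ v) = (class_of u * class_of v)%g.
Proof. by rewrite -presented_mulE. Qed.

End PresentedGroup.

(* Indices are shifted: i : 'I_n.-1 stands for the index i + 1 of the
   generators sigma_1, ..., sigma_{n-1}; superscripts a : 'I_k are unshifted. *)
Definition mkwb_gen (n k : nat) : choiceType := ('I_n.-1 + 'I_n.-1 * 'I_k)%type.

Definition far (n : nat) (i j : 'I_n) : bool := (i.+2 <= j) || (j.+2 <= i).

Section MultiWelded.
Variables n k : nat.

Definition ltr_sigma (i : 'I_n.-1) : mkwb_gen n k * bool := (inl i, false).
Definition ltr_rho (a : 'I_k) (i : 'I_n.-1) : mkwb_gen n k * bool :=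
  (inr (i, a), false).

Local Notation s := ltr_sigma.
Local Notation r := ltr_rho.

Inductive mkwb_rel : word (mkwb_gen n k) -> word (mkwb_gen n k) -> Prop :=
| SigmaBraid (i j : 'I_n.-1) : j = i.+1 :> nat ->
    mkwb_rel [:: s i; s j; s i] [:: s j; s i; s j]
| SigmaFar (i j : 'I_n.-1) : far i j ->
    mkwb_rel [:: s i; s j] [:: s j; s i]
| RhoInvol (a : 'I_k) (i : 'I_n.-1) :
    mkwb_rel [:: r a i; r a i] [::]
| RhoFar (a : 'I_k) (i j : 'I_n.-1) : far i j ->
    mkwb_rel [:: r a i; r a j] [:: r a j; r a i]
| RhoBraid (a : 'I_k) (i j : 'I_n.-1) : j = i.+1 :> nat ->
    mkwb_rel [:: r a i; r a j; r a i] [:: r a j; r a i; r a j]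
| SigmaRhoFar (a : 'I_k) (i j : 'I_n.-1) : far i j ->
    mkwb_rel [:: s i; r a j] [:: r a j; s i]
| RhoRhoFar (a b : 'I_k) (i j : 'I_n.-1) : far i j -> a != b ->
    mkwb_rel [:: r a i; r b j] [:: r b j; r a i]
| SigmaRho0 (z : 'I_k) (i j : 'I_n.-1) : z = 0 :> nat -> j = i.+1 :> nat ->
    mkwb_rel [:: s i; r z j; r z i] [:: r z j; r z i; s j]
| RhoRho0 (z b : 'I_k) (i j : 'I_n.-1) :
    z = 0 :> nat -> 1 <= b -> j = i.+1 :> nat ->
    mkwb_rel [:: r z i; r z j; r b i] [:: r b j; r z i; r z j]
| ForbiddenF1 (a : 'I_k) (i j : 'I_n.-1) : j = i.+1 :> nat ->
    mkwb_rel [:: s i; s j; r a i] [:: r a j; s i; s j].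

Definition MkWB : groupType := presented mkwb_rel.

Definition sigma (i : 'I_n.-1) : MkWB := gen mkwb_rel (inl i).
Definition rho (a : 'I_k) (i : 'I_n.-1) : MkWB := gen mkwb_rel (inr (i, a)).

End MultiWelded.

Arguments sigma {n} k i.

Local Open Scope ring_scope.

(* GL_n(F) as a group; the library's 'GL_n[F] is restricted to finite F. *)
Record GL (n : nat) (F : fieldType) : Type :=
  MkGL { GL_mx : 'M[F]_n; GL_unitmx : GL_mx \in unitmx }.

Section GeneralLinear.
Variables (n : nat) (F : fieldType).

HB.instance Definition _ := [isSub for @GL_mx n F].
HB.instance Definition _ := [Choice of GL n F by <:].

Definition GL_one : GL n F := MkGL (unitmx1 F n).

Lemma GL_mul_subproof (M N : GL n F) : GL_mx M *m GL_mx N \in unitmx.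
Proof. by rewrite unitmx_mul (GL_unitmx M) (GL_unitmx N). Qed.
Definition GL_mul (M N : GL n F) : GL n F := MkGL (GL_mul_subproof M N).

Lemma GL_inv_subproof (M : GL n F) : invmx (GL_mx M) \in unitmx.
Proof. by rewrite unitmx_inv (GL_unitmx M). Qed.
Definition GL_inv (M : GL n F) : GL n F := MkGL (GL_inv_subproof M).

Lemma GL_mulA : associative GL_mul.
Proof. by move=> M N P; apply/val_inj; rewrite /= mulmxA. Qed.

Lemma GL_mul1 : left_id GL_one GL_mul.
Proof. by move=> M; apply/val_inj; rewrite /= mul1mx. Qed.

Lemma GL_mulr1 : right_id GL_one GL_mul.
Proof. by move=> M; apply/val_inj; rewrite /= mulmx1. Qed.

Lemma GL_mulV : left_inverse GL_one GL_inv GL_mul.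
Proof. by move=> M; apply/val_inj; rewrite /= mulVmx ?(GL_unitmx M). Qed.

Lemma GL_mulrV : right_inverse GL_one GL_inv GL_mul.
Proof. by move=> M; apply/val_inj; rewrite /= mulmxV ?(GL_unitmx M). Qed.

HB.instance Definition _ := isGroup.Build (GL n F)
  GL_mulA GL_mul1 GL_mulr1 GL_mulV GL_mulrV.

End GeneralLinear.

Lemma E_dim (n : nat) (i : 'I_n.-1) : (i + (2 + (n - i.+2)) = n)%N.
Proof. by case: n i => [|n] [i lt_in] //=; rewrite addnA addn2 subnKC. Qed.

(* diag(I_{i-1}, M, I_{n-i-1}), with i shifted by one as above. *)
Definition E (F : fieldType) (n : nat) (i : 'I_n.-1) (M : 'M[F]_2) : 'M[F]_n :=
  castmx (E_dim i, E_dim i)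
    (block_mx (1%:M : 'M_i) 0
              0 (block_mx M 0
                          0 (1%:M : 'M_(n - i.+2)))).

Definition mx2 (F : fieldType) (a b c d : F) : 'M[F]_2 :=
  \matrix_(i, j) if i == 0 then (if j == 0 then a else b)
                 else (if j == 0 then c else d).

Definition antidiag (F : fieldType) (x : F) : 'M[F]_2 := mx2 0 x (1 / x) 0.

Section Representations.
Variables (F : fieldType) (n k : nat).
Implicit Type zeta : {multiplicative MkWB n k -> GL n F}.

Definition of_form zeta (A : 'M[F]_2) (Y : 'I_k -> 'M[F]_2) : Prop :=
  (forall i, GL_mx (zeta (sigma k i)) = E i A) /\
  (forall a i, GL_mx (zeta (rho a i)) = E i (Y a)).

Definition homogeneous_2local zeta : Prop :=
  exists (A : GL 2 F) (Y : 'I_k -> GL 2 F),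
    of_form zeta (GL_mx A) (fun a => GL_mx (Y a)).

Definition equivalent zeta zeta' : Prop :=
  exists P : GL n F, forall g, zeta' g = (P^-1 * zeta g * P)%g.

Definition trivial_rep zeta : Prop :=
  (forall i, zeta (sigma k i) = 1%g) /\ (forall a i, zeta (rho a i) = 1%g).

End Representations.

Inductive A_form : predArgType := Form_i_left | Form_i_right | Form_ii.

Definition A_form_code (f : A_form) : 'I_3 :=
  match f with
  | Form_i_left => @Ordinal 3 0 isT
  | Form_i_right => @Ordinal 3 1 isT
  | Form_ii => @Ordinal 3 2 isT
  end.

Definition A_form_decode (i : 'I_3) : A_form :=
  match val i with 0%N => Form_i_left | 1%N => Form_i_right | _ => Form_ii end.

Lemma A_form_codeK : cancel A_form_code A_form_decode.
Proof. by case. Qed.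

HB.instance Definition _ := Finite.copy A_form (can_type A_form_codeK).

Definition positive_ord (k : nat) : finType := {a : 'I_k | (0 < a)%N}.

(* None labels the trivial representation; Some (f, D) labels the type in which
   A has the form f and D is the set of the a >= 1 such that Y_a is
   antidiagonal, the other Y_a (a >= 1) being the identity. *)
Definition rep_type (k : nat) : finType :=
  option (A_form * {set positive_ord k}).

Section Classification.
Variables (F : fieldType) (k : nat).
Implicit Types (A : 'M[F]_2) (Y : 'I_k -> 'M[F]_2) (D : {set positive_ord k}).

Definition Y_cond_i (b : F) D Y : Prop :=
  (forall z : 'I_k, z = 0%N :> nat -> Y z = antidiag b) /\
  (forall a : positive_ord k,
     Y (val a) = if a \in D then antidiag b else 1%:M).

Definition Y_cond_ii D Y : Prop :=
  (forall z : 'I_k, z = 0%N :> nat ->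
     exists2 x : F, x != 0 & Y z = antidiag x) /\
  (forall a : positive_ord k,
     if a \in D then exists2 x : F, x != 0 & Y (val a) = antidiag x
     else Y (val a) = 1%:M).

Definition AY_cond (f : A_form) D A Y : Prop :=
  match f with
  | Form_i_left => exists b c : F,
      [/\ b * c != 0, A = mx2 (1 - b * c) b c 0 & Y_cond_i b D Y]
  | Form_i_right => exists b d : F,
      [/\ b != 0, d != 1, A = mx2 0 b ((1 - d) / b) d & Y_cond_i b D Y]
  | Form_ii => exists b c : F,
      [/\ b * c != 0, A = mx2 0 b c 0 & Y_cond_ii D Y]
  end.

Definition of_type (n : nat) (t : rep_type k)
    (zeta : {multiplicative MkWB n k -> GL n F}) : Prop :=
  match t with
  | None => trivial_rep zeta
  | Some (f, D) => exists A Y, of_form zeta A Y /\ AY_cond f D A Y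
  end.

End Classification.

(* Main.v *)
Require Import Defs.
From mathcomp Require Import all_boot all_order all_algebra.
From mathcomp Require Import reals complex.
From mathcomp Require Import ring zify.

Set Implicit Arguments.
Unset Strict Implicit.
Unset Printing Implicit Defensive.

Import GRing.Theory.

(** No change of basis is needed: the defining relations already force the pair
    (A, (Y_a)) into one of the listed shapes, so the conjugating matrix is the
    identity.

    Only the generators with the two lowest indices matter.  Their images act on
    the first three coordinates and fix the others, so each relation between
    them is an identity between 3 x 3 matrices ([E_first], [E_second]).  Three
    families of relations are instances of a single one,
      [slides A Y] : E_1(A) E_2(A) E_1(Y) = E_2(Y) E_1(A) E_2(A).
    It is the forbidden move F1 for Y = Y_a, the braid relation of the sigma_i
    for Y = A, and the braid relation of the rho_i^a when A and Y are both Y_a.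
    So one 3 x 3 computation, [slides_eqs], gives the equations of all three.

    - [slides A A] leaves A = 1 or bc != 0 with at most one nonzero diagonal
      entry, which is then 1 - bc ([slides_self]).
    - If [slides Y Y] and Y^2 = 1, then Y is the identity or [antidiag x]
      ([slides_involution]).
    - If A = 1, every Y_a slides over the identity, hence is the identity: this
      is the trivial representation ([slides_id]).
    - If A <> 1, then Y_0 is not the identity, as otherwise the relation
      sigma_1 rho_2^0 rho_1^0 = rho_2^0 rho_1^0 sigma_2 would read
      E_1(A) = E_2(A) ([E1_eq_E2]).
    - A nonzero diagonal entry of A forces x = b for each Y_a = [antidiag x]
      ([slides_antidiag]); this is what separates the forms (i) from (ii). *)

(** * Counting the types *)

Lemma card_positive_ord k : #|positive_ord k| = k.-1.
Proof.
rewrite card_sig; case: k => [|k]; first by apply: eq_card0 => -[].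
rewrite -[RHS](card_ord k) -(card_image (@lift_inj k.+1 ord0)).
apply: eq_card => j; rewrite !inE; apply/idP/imageP => [j_gt0 | [i _ ->]] //.
case: (unliftP ord0 j) j_gt0 => [i ->|->] //.
by exists i.
Qed.

Lemma card_A_form : #|A_form| = 3.
Proof.
rewrite -(card_ord 3); apply: (bij_eq_card (f := A_form_code)).
exists A_form_decode; first exact: A_form_codeK.
by case=> -[|[|[]]] //= ?; apply: val_inj.
Qed.

Lemma card_rep_type k : #|rep_type k| = (3 * 2 ^ (k - 1) + 1)%N.
Proof.
rewrite card_option card_prod card_A_form -cardsT -powersetT card_powerset.
by rewrite cardsT card_positive_ord subn1 addn1.
Qed.

Local Open Scope ring_scope.

(** * Matrices of size two *)

Section TwoByTwo.
Variable F : fieldType.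
Implicit Types M N : 'M[F]_2.

Lemma mx2_eta M : M = mx2 (M 0 0) (M 0 1) (M 1 0) (M 1 1).
Proof.
apply/matrixP => p q; rewrite mxE.
by case: p q => -[|[|[]]] // ? [[|[|[]]] // ?]; congr (M _ _); apply: val_inj.
Qed.

Lemma mx2_id : mx2 1 0 0 1 = 1%:M :> 'M[F]_2.
Proof. by rewrite [RHS]mx2_eta !mxE. Qed.

Lemma unitmx_mx2 (a b c d : F) :
  (mx2 a b c d \in unitmx) = (a * d - b * c != 0).
Proof.
rewrite unitmxE unitfE (expand_det_row _ 0) !big_ord_recl big_ord0 /cofactor.
by rewrite !det_mx11 !mxE /= mul1r mulN1r mulrN addr0.
Qed.

Lemma mx2_sq (a b c d : F) : mx2 a b c d *m mx2 a b c d =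
  mx2 (a * a + b * c) (a * b + b * d) (c * a + d * c) (c * b + d * d).
Proof. by rewrite [LHS]mx2_eta !mxE !big_ord_recl !big_ord0 !mxE /= !addr0. Qed.

End TwoByTwo.

(** * Block embeddings *)

Section Local.
Variable F : fieldType.
Implicit Types A M N Y : 'M[F]_2.

Lemma castmx_sq_mul m n (e : m = n) (M N : 'M[F]_m) :
  castmx (e, e) M *m castmx (e, e) N = castmx (e, e) (M *m N).
Proof. by case: n / e; rewrite !castmx_id. Qed.

Lemma castmx_sq1 m n (e : m = n) : castmx (e, e) 1%:M = 1%:M :> 'M[F]_n.
Proof. by case: n / e; rewrite castmx_id. Qed.

Lemma E_mul n (i : 'I_n.-1) M N : E i M *m E i N = E i (M *m N).
Proof.
rewrite castmx_sq_mul !mulmx_block.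
by rewrite !(mulmx0, mul0mx, addr0, add0r, mulmx1).
Qed.

Lemma E_id n (i : 'I_n.-1) : E i 1%:M = 1%:M :> 'M[F]_n.
Proof. by rewrite /E -!scalar_mx_block castmx_sq1. Qed.

(** Outside the 2 x 2 block the matrix agrees with the identity; the values of
    [inord] are meaningful only under the test on the indices. *)
Lemma E_entry n (i : 'I_n.-1) M (p q : 'I_n) :
  E i M p q = if (i <= p < i.+2)%N && (i <= q < i.+2)%N
              then M (inord (p - i)) (inord (q - i)) else (p == q)%:R.
Proof.
rewrite castmxE -val_eqE /=.
set p' := cast_ord _ p; set q' := cast_ord _ q.
have [-> ->] : nat_of_ord p = p' /\ nat_of_ord q = q' by [].
move: p' q' => {}p {}q.
rewrite mxE; case: splitP => p1 ep; rewrite mxE.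
  have lt_p1 := ltn_ord p1; rewrite ifN ?ep; last by apply/negP; lia.
  case: splitP => q1 ->; rewrite !mxE -?val_eqE //.
  by case: eqP => // ?; lia.
case: splitP => q1 eq_q; rewrite mxE.
  have lt_q1 := ltn_ord q1; rewrite ifN ?ep ?eq_q; last by apply/negP; lia.
  by case: eqP => // ?; lia.
case: splitP => p2 ep2; rewrite mxE; case: splitP => q2 eq_q2; rewrite ?mxE.
- have lt_p2 := ltn_ord p2; have lt_q2 := ltn_ord q2.
  rewrite ifT ep ep2 eq_q eq_q2 ?addKn ?inord_val //; lia.
- have lt_p2 := ltn_ord p2; rewrite ifN ep ep2 eq_q eq_q2; last by apply/negP; lia.
  by case: eqP => // ?; lia.
- have lt_q2 := ltn_ord q2; rewrite ifN ep ep2 eq_q eq_q2; last by apply/negP; lia.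
  by case: eqP => // ?; lia.
- rewrite ifN ep ep2 eq_q eq_q2; last by apply/negP; lia.
  by rewrite !eqn_add2l.
Qed.

Lemma E_inj n (i : 'I_n.-1) : injective (@E F n i).
Proof.
move=> M N eqMN; apply/matrixP => p q.
have lt_in (r : 'I_2) : (i + r < n)%N by move: (ltn_ord i) (ltn_ord r); lia.
move/matrixP/(_ (Ordinal (lt_in p)) (Ordinal (lt_in q))): eqMN.
rewrite !E_entry /= !leq_addr -[i.+2]addn2 !ltn_add2l !ltn_ord /=.
by rewrite !addKn !inord_val.
Qed.

Definition mx3 (a b c d e f g h j : F) : 'M[F]_3 :=
  \matrix_(p, q) nth 0 (nth [::] [:: [:: a; b; c]; [:: d; e; f]; [:: g; h; j]] p) q.

Lemma mx3_mul (a b c d e f g h j a' b' c' d' e' f' g' h' j' : F) :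
  mx3 a b c d e f g h j *m mx3 a' b' c' d' e' f' g' h' j' =
  mx3 (a * a' + b * d' + c * g') (a * b' + b * e' + c * h')
      (a * c' + b * f' + c * j')
      (d * a' + e * d' + f * g') (d * b' + e * e' + f * h')
      (d * c' + e * f' + f * j')
      (g * a' + h * d' + j * g') (g * b' + h * e' + j * h')
      (g * c' + h * f' + j * j').
Proof.
apply/matrixP => p q; rewrite !mxE !big_ord_recl big_ord0 !mxE /= addr0 addrA.
by case: p q => -[|[|[|]]] // ? [[|[|[|]]] // ?].
Qed.

(** Together with [E_second], this makes the products of the first two block
    embeddings, in any dimension at least 3, products of 3 x 3 matrices: the
    block form is preserved by multiplication. *)
Lemma E_first m (a b c d : F) :
  E (n := m.+3) ord0 (mx2 a b c d) =
  block_mx (mx3 a b 0 c d 0 0 0 1) 0 0 1%:M :> 'M[F]_(3 + m).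
Proof.
apply/matrixP => p q; rewrite E_entry !mxE -!val_eqE /=.
case: splitP => p1 ->; rewrite mxE; case: splitP => q1 ->; rewrite !mxE //=.
- case: p1 q1 => -[|[|[|]]] // ? [[|[|[|]]] // ?] /=;
  by rewrite ?subn0 ?inordK.
- by case: p1 => -[|[|[|]]].
- by case: q1 => -[|[|[|]]].
Qed.

Lemma E_second m (a b c d : F) :
  E (n := m.+3) (lift ord0 ord0) (mx2 a b c d) =
  block_mx (mx3 1 0 0 0 a b 0 c d) 0 0 1%:M :> 'M[F]_(3 + m).
Proof.
apply/matrixP => p q; rewrite E_entry !mxE -!val_eqE /=.
case: splitP => p1 ->; rewrite mxE; case: splitP => q1 ->; rewrite !mxE //=.
- case: p1 q1 => -[|[|[|]]] // ? [[|[|[|]]] // ?] /=;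
  by rewrite ?subn0 ?inordK.
- by case: p1 => -[|[|[|]]].
- by case: q1 => -[|[|[|]]].
Qed.

End Local.

(** * The sliding relation *)

Section Slides.
Variables (F : fieldType) (m : nat).
Implicit Types A Y : 'M[F]_2.

Definition E1 A : 'M[F]_m.+3 := E (n := m.+3) ord0 A.
Definition E2 A : 'M[F]_m.+3 := E (n := m.+3) (lift ord0 ord0) A.

(** The common shape of F1 and of both braid relations: Y passes from the first
    position to the second across [E1 A *m E2 A]. *)
Definition slides A Y := E1 A *m E2 A *m E1 Y = E2 Y *m E1 A *m E2 A.

(** These are the entries (0,0), (0,1), (1,0), (1,1), (1,2) and (2,2) of the
    3 x 3 identity; the (2,1) entry repeats the (1,0) one, and (0,2) and (2,0)
    are tautologies. *)
Lemma slides_eqs (a b c d x y z w : F) :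
  slides (mx2 a b c d) (mx2 x y z w) ->
  [/\ a * (x + b * z) = a, a * (y + b * w) = a * b, a * d * z = 0
    & [/\ a * d * (w - x) = 0, d * (x * b + y) = d * b & d * (z * b + w) = d]].
Proof.
rewrite /slides /E1 /E2 !E_first !E_second.
rewrite -[_.+3]/(3 + m)%N !mulmx_block !(mul0mx, mulmx0, mulmx1, addr0, add0r).
case/eq_block_mx => + _ _ _; rewrite !mx3_mul => /matrixP eqs.
have e00 := eqs 0 0; have e01 := eqs 0 1; have e10 := eqs 1 0.
have e11 := eqs 1 1; have e12 := eqs 1 2%:R; have e22 := eqs 2%:R 2%:R.
rewrite !mxE /= in e00 e01 e10 e11 e12 e22.
have sub_eq (s t u v : F) : s = t -> u - v = s - t -> u = v.
  by move=> ->; rewrite subrr => /subr0_eq.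
split; last split.
- by apply: (sub_eq _ _ _ _ e00); ring.
- by apply: (sub_eq _ _ _ _ e01); ring.
- by apply: (sub_eq _ _ _ _ e10); ring.
- by apply: (sub_eq _ _ _ _ e11); ring.
- by apply: (sub_eq _ _ _ _ (esym e12)); ring.
- by apply: (sub_eq _ _ _ _ (esym e22)); ring.
Qed.

(** The equations a (a + bc - 1) = 0 and d (d + bc - 1) = 0 determine each
    diagonal entry that is nonzero.  If both are nonzero, then acd = abd = 0 and
    ad (d - a) = 0 give the identity; if one vanishes, the determinant shows
    that bc is nonzero. *)
Lemma slides_self A : A \in unitmx -> slides A A ->
  A = 1%:M \/ exists b c, b * c != 0 /\
    [\/ A = mx2 0 b c 0, 1 - b * c != 0 /\ A = mx2 (1 - b * c) b c 0
      | 1 - b * c != 0 /\ A = mx2 0 b c (1 - b * c)].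
Proof.
rewrite (mx2_eta A); move: (A 0 0) (A 0 1) (A 1 0) (A 1 1) => a b c d.
rewrite unitmx_mx2 => det_neq0 /slides_eqs[e1 _ e3 [e4 e5 e6]].
have [a0|a_neq0] := eqVneq a 0; have [d0|d_neq0] := eqVneq d 0.
- right; exists b, c; split; last by apply: Or31; rewrite a0 d0.
  by move: det_neq0; rewrite a0 mul0r sub0r oppr_eq0.
- have dE : d = 1 - b * c.
    by apply: (mulfI d_neq0); rewrite mulrBr mulr1 -[X in X - _]e6; ring.
  right; exists b, c; split.
    by move: det_neq0; rewrite a0 mul0r sub0r oppr_eq0.
  by apply: Or33; rewrite -dE a0.
- have aE : a = 1 - b * c.
    by apply: (mulfI a_neq0); rewrite mulrBr mulr1 -[X in X - _]e1; ring.
  right; exists b, c; split.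
    by move: det_neq0; rewrite d0 mulr0 sub0r oppr_eq0.
  by apply: Or32; rewrite -aE d0.
- have ad_neq0 : a * d != 0 by rewrite mulf_neq0.
  have c0 : c = 0 by apply: (mulfI ad_neq0); rewrite e3 mulr0.
  have a1 : a = 1 by apply: (mulfI a_neq0); rewrite mulr1 -[RHS]e1 c0; ring.
  have da : d = a.
    by apply/eqP; rewrite -subr_eq0; apply/eqP/(mulfI ad_neq0); rewrite mulr0.
  left; rewrite -mx2_id; congr mx2 => //; last by rewrite da.
  by apply: (mulfI d_neq0); rewrite mulr0 -(subrr (d * b)) -{2}e5 a1; ring.
Qed.

(** In the shapes of [slides_self] with a nonzero diagonal entry t, the upper
    right entry of Y^2 is tb, which cannot vanish; in the remaining shape Y^2 = 1
    reads bc = 1. *)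
Lemma slides_involution Y : Y \in unitmx -> Y *m Y = 1%:M -> slides Y Y ->
  Y = 1%:M \/ exists2 x, x != 0 & Y = antidiag x.
Proof.
rewrite -mx2_id => uY YY /(slides_self uY)[|[b [c [bc_neq0 forms]]]].
  by rewrite mx2_id; left.
have entry p q := congr1 (fun M : 'M[F]_2 => M p q) YY.
have offdiag_eq0 (t u : F) : u != 0 -> t != 0 /\ t * u = 0 -> False.
  by move=> u0 [t0 /eqP]; rewrite mulf_eq0 (negPf t0) (negPf u0).
have b_neq0 : b != 0 by apply: contraNneq bc_neq0 => ->; rewrite mul0r.
case: forms => [Y_E|[a_neq0 Y_E]|[d_neq0 Y_E]]; have := entry 0 1; have := entry 0 0;
  rewrite Y_E mx2_sq !mxE /= => e00 e01.
- right; exists b => //; congr mx2; rewrite mul0r add0r in e00.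
  by apply: (mulfI b_neq0); rewrite e00 mul1r mulfV.
- by case: (offdiag_eq0 _ _ b_neq0 (conj a_neq0 _)); rewrite -e01; ring.
- by case: (offdiag_eq0 _ _ b_neq0 (conj d_neq0 _)); rewrite -e01; ring.
Qed.

Lemma slides_id Y : slides 1%:M Y -> Y = 1%:M.
Proof.
rewrite (mx2_eta Y) -mx2_id => /slides_eqs.
case; rewrite !(mul1r, mul0r, addr0, mulr0) => -> -> -> [/eqP].
by rewrite subr_eq0 => /eqP -> _ _.
Qed.

(** The first row of the sliding relation gives ax = ab, the last column gives
    dx = db. *)
Lemma slides_antidiag (a b c d x : F) : b != 0 -> (a != 0) || (d != 0) ->
  slides (mx2 a b c d) (antidiag x) -> x = b.
Proof.
move=> b_neq0 ad /slides_eqs[_ + _ [_ + _]].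
rewrite !(mul0r, mulr0, add0r, addr0) => ax dx.
by case/orP: ad => [a_neq0|d_neq0]; [apply: (mulfI a_neq0) | apply: (mulfI d_neq0)].
Qed.

(** The two embedded copies of A overlap in the middle coordinate only, so outside
    it each must agree with the identity part of the other. *)
Lemma E1_eq_E2 A : E1 A = E2 A -> A = 1%:M.
Proof.
rewrite (mx2_eta A) /E1 /E2 E_first E_second.
move: (A 0 0) (A 0 1) (A 1 0) (A 1 1) => a b c d.
case/(@eq_block_mx _ 3 m 3 m) => /matrixP eqs _ _ _.
have e00 := eqs 0 0; have e01 := eqs 0 1.
have e10 := eqs 1 0; have e22 := eqs 2%:R 2%:R.
by rewrite !mxE /= in e00 e01 e10 e22; rewrite e00 e01 e10 -e22 mx2_id.
Qed.

(** The whole classification, once the relations of the group are expressed as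
    matrix identities.  The last hypothesis excludes Y_0 = 1 when A <> 1.  The
    second form in (i) also allows a zero diagonal, but its Y_a all share the
    parameter b, which nothing enforces there: a zero diagonal has to go
    to (ii). *)
Lemma matrix_forms k (A : 'M[F]_2) (Y : 'I_k -> 'M[F]_2) (z : 'I_k) :
  z = 0%N :> nat -> A \in unitmx -> (forall a, Y a \in unitmx) ->
  slides A A -> (forall a, Y a *m Y a = 1%:M) -> (forall a, slides (Y a) (Y a)) ->
  (forall a, slides A (Y a)) ->
  E1 A *m E2 (Y z) *m E1 (Y z) = E2 (Y z) *m E1 (Y z) *m E2 A ->
  (A = 1%:M /\ forall a, Y a = 1%:M) \/
  exists f (D : {set positive_ord k}), AY_cond f D A Y.
Proof.
move=> z0 uA uY sAA YY sYY sAY mixed.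
case: (slides_self uA sAA) => [A1|[b [c [bc_neq0 forms]]]].
  by left; split=> // a; apply: slides_id; rewrite -A1.
have Yforms a := slides_involution (uY a) (YY a) (sYY a).
(* The entry b of A in position (0,1) is nonzero, as bc is. *)
have A_neq1 : A <> 1%:M.
  move=> A1; have := bc_neq0.
  case: forms => [A_E|[_ A_E]|[_ A_E]];
  have := congr1 (fun M : 'M[F]_2 => M 0 1) A_E;
  by rewrite A1 !mxE /= => <-; rewrite mul0r eqxx.
have Yz : exists2 x, x != 0 & Y z = antidiag x.
  case: (Yforms z) => // Yz1; case: A_neq1; apply: E1_eq_E2.
  by move: mixed; rewrite Yz1 /E1 /E2 !E_id !mulmx1 mul1mx.
have eq_z (a : 'I_k) : a = 0%N :> nat -> a = z.
  by move=> a0; apply: ord_inj; rewrite a0 z0.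
right.
pose D := [set a : positive_ord k | Y (val a) != 1%:M].
have Yi : (forall x a, Y a = antidiag x -> x = b) -> Y_cond_i b D Y.
  move=> Yb; split=> [a /eq_z->|a].
    by have [x _ Yx] := Yz; rewrite {1}Yx (Yb _ _ Yx).
  rewrite inE; case: eqP => // Y_neq1.
  by case: (Yforms (val a)) => // -[x _ Yx]; rewrite {1}Yx (Yb _ _ Yx).
have b_neq0 : b != 0 by apply: contraNneq bc_neq0 => ->; rewrite mul0r.
case: forms => [A_E|[a_neq0 A_E]|[d_neq0 A_E]].
- exists Form_ii, D, b, c; split=> //; split=> [a /eq_z-> //|a].
  by rewrite inE; case: eqP => // Y_neq1; case: (Yforms (val a)).
- exists Form_i_left, D, b, c; split=> //; apply: Yi => x a Ya.
  by apply: (@slides_antidiag (1 - b * c) b c 0); rewrite ?a_neq0 // -A_E -Ya.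
- exists Form_i_right, D, b, (1 - b * c); split=> //.
  + by rewrite -subr_eq0 addrAC subrr sub0r oppr_eq0.
  + by rewrite A_E; congr mx2; field.
  apply: Yi => x a Ya.
  by apply: (@slides_antidiag 0 b c (1 - b * c)); rewrite ?d_neq0 ?orbT // -A_E -Ya.
Qed.

End Slides.

(** * From group relations to matrix identities *)

Section Classification.
Variables (F : fieldType) (m k : nat).
Variable zeta : {multiplicative MkWB m.+3 k -> GL m.+3 F}.

Definition ev (u : word (mkwb_gen m.+3 k)) : 'M[F]_m.+3 :=
  GL_mx (zeta (class_of (@mkwb_rel m.+3 k) u)).

Lemma ev_cons p u : ev (p :: u) = ev [:: p] *m ev u.
Proof. by rewrite /ev -cat1s class_of_cat gmulfM. Qed.

Lemma ev_nil : ev [::] = 1%:M.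
Proof.
have : zeta 1%g = 1%g by apply: (mulgI (zeta 1%g)); rewrite -gmulfM !mulg1.
by move/(congr1 (@GL_mx _ _)).
Qed.

Lemma ev_rel u v : mkwb_rel u v -> ev u = ev v.
Proof. by move=> uv; congr (GL_mx (zeta _)); apply/class_ofP/WordRel. Qed.

Lemma classification : (0 < k)%N -> homogeneous_2local zeta ->
  exists t : rep_type k, of_type t zeta.
Proof.
move=> k_gt0 [A [Y [zs zr]]].
have s_ev i : ev [:: ltr_sigma k i] = E i (GL_mx A) := zs i.
have r_ev a i : ev [:: ltr_rho a i] = E i (GL_mx (Y a)) := zr a i.
have evE := (ev_nil, s_ev, r_ev).
pose i1 : 'I_m.+2 := ord0; pose i2 : 'I_m.+2 := lift ord0 ord0.
have i12 : i2 = i1.+1 :> nat by [].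
pose z := Ordinal k_gt0.
have := @matrix_forms F m k (GL_mx A) (fun a => GL_mx (Y a)) z erefl
  (Defs.GL_unitmx A) (fun a => Defs.GL_unitmx (Y a)).
case.
- have := ev_rel (@SigmaBraid m.+3 k i1 i2 i12).
  by rewrite !(ev_cons _ (_ :: _)) !evE !mulmxA.
- move=> a; have := ev_rel (@RhoInvol m.+3 k a i1).
  by rewrite !(ev_cons _ (_ :: _)) !evE E_mul -[RHS](@E_id F m.+3 i1) => /E_inj.
- move=> a; have := ev_rel (@RhoBraid m.+3 k a i1 i2 i12).
  by rewrite !(ev_cons _ (_ :: _)) !evE !mulmxA.
- move=> a; have := ev_rel (@ForbiddenF1 m.+3 k a i1 i2 i12).
  by rewrite !(ev_cons _ (_ :: _)) !evE !mulmxA.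
- have := ev_rel (@SigmaRho0 m.+3 k z i1 i2 erefl i12).
  by rewrite !(ev_cons _ (_ :: _)) !evE !mulmxA.
- case=> A1 Y1; exists None; split=> [i|a i]; apply: val_inj => /=.
    by rewrite zs A1 E_id.
  by rewrite zr Y1 E_id.
- case=> f [D AY]; exists (Some (f, D)), (GL_mx A), (fun a => GL_mx (Y a)).
  by split.
Qed.

End Classification.

Theorem theorem4p1 (R : realType) (n k : nat) (hn : (3 <= n)%N) (hk : (1 < k)%N)
    (zeta : {multiplicative MkWB n k -> GL n (complex R)}) :
  homogeneous_2local zeta ->
  #|rep_type k| = (3 * 2 ^ (k - 1) + 1)%N /\
  exists (t : rep_type k)
         (zeta' : {multiplicative MkWB n k -> GL n (complex R)}),
    of_type t zeta' /\ equivalent zeta zeta'.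
Proof.
move=> zeta_hom; split; first exact: card_rep_type.
case: n hn zeta zeta_hom => [|[|[|m]]] // _ zeta zeta_hom.
have [t zeta_t] := classification (ltnW hk) zeta_hom.
exists t, zeta; split=> //; exists 1%g => g.
by rewrite invg1 mul1g mulg1.
Qed.
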